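(* For any undirected graph $G=(V,E)$ with $n=|V|$ and all degrees at least $1$, any $\alpha\in(0,1)$, $s\in V$ and $\varepsilon_d>0$, with probability at least $1-1/n$ the output of Algorithm D (described in the context) satisfies $\big|\hat\pi(s,t)/d(t)-\pi(s,t)/d(t)\big|\le\varepsilon_d$ for all $t\in V$.
   Context: $d(v)$ is the degree of $v$, $\mathcal N(v)$ its neighbor set (each undirected edge is viewed as two opposite directed edges). An $\alpha$-discounted random walk from $u$ terminates at its current node with probability $\alpha$ before each step and otherwise moves to a uniformly random neighbor; $\pi(u,v)$ is the probability that it terminates at $v$. Monte Carlo estimates with $k$ walks: simulate $k$ independent such walks from $s$ and estimate $\pi(s,v)$ by the fraction terminating at $v$. RBS is a randomized subroutine $\mathrm{RBS}(G,\alpha,t,\varepsilon_r,\delta,p_f)$ returning estimates $\pi'(v,t)$, $v\in V$, such that with probability at least $1-p_f$: $|\pi'(v,t)-\pi(v,t)|\le\varepsilon_r\pi(v,t)$ for all $v$ with $\pi(v,t)\ge\delta$, and $\pi'(v,t)\le\pi(v,t)+\delta$ for all $v$ with $\pi(v,t)<\delta$. BackwardPush$(t,r_{\max})$: set $q(v,t)=0$ for all $v$, $r(t,t)=1$, $r(v,t)=0$ for $v\ne t$; while some $v$ has $r(v,t)>r_{\max}$, pick any such $v$, add $(1-\alpha)r(v,t)/d(u)$ to $r(u,t)$ for each $u\in\mathcal N(v)$, then add $\alpha r(v,t)$ to $q(v,t)$ and set $r(v,t)=0$; return all $q(v,t),r(v,t)$. Algorithm D (input $G,\alpha,s,\varepsilon_d$).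 Phase I: $\pi'(v,s)\leftarrow\mathrm{RBS}(G,\alpha,s,\frac12,\frac14\varepsilon_d d(s),1/n^2)$; set $\pi'(s,v)=\pi'(v,s)d(v)/d(s)$ for each $v$ with $\pi'(v,s)\ne0$ (and $0$ otherwise); $C=\{t:\pi'(s,t)/d(t)>\frac12\varepsilon_d\}$. Phase II: $n_r=\lceil n/\varepsilon_d\rceil$, $n_t=\lceil 18\ln(2n^2)\rceil$, $r_{\max}(t)=d(t)^2\varepsilon_d^2 n_r/(6\pi'(s,t))$ for $t\in C$. Repeat: for each $t\in C$ run BackwardPush$(t,\frac12 r_{\max}(t))$, but as soon as the total cost of Backward Push in the current repetition exceeds the expected cost of simulating $n_t\cdot\frac12 n_r$ random walks, abort and leave the repetition loop; if all $t\in C$ complete, set $n_r=\lfloor n_r/2\rfloor$, $r_{\max}(t)=\frac12 r_{\max}(t)$ for all $t\in C$, and repeat. After leaving the loop, run BackwardPush$(t,r_{\max}(t))$ with the current values for each $t\in C$, obtaining $q(v,t),r(v,t)$. Phase III: for $i=1,\dots,n_t$, independently compute Monte Carlo estimates $\pi''_i(s,v)$ with $n_r$ walks and set $\hat\pi_i(s,t)=q(s,t)+\sum_{v}\pi''_i(s,v)r(v,t)$ for $t\in C$. Output $\hat\pi(s,t)=$ the $\lceil n_t/2\rceil$-th smallest of $\hat\pi_1(s,t),\dots,\hat\pi_{n_t}(s,t)$ for $t\in C$, and $0$ for $t\notin C$. *)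

(* Defs.v *)
From HB Require Import structures.
From mathcomp Require Import all_boot all_order all_algebra.
From mathcomp Require Import all_classical all_reals all_analysis.

Set Implicit Arguments.
Unset Strict Implicit.
Unset Printing Implicit Defensive.

Import Order.TTheory GRing.Theory Num.Theory.

Local Open Scope classical_set_scope.
Local Open Scope ring_scope.

(* The result of [while cont x do x := body x]; [None] means divergence. *)
Definition while (T : Type) (cont : T -> bool) (body : T -> T) (x : T) :
    option T :=
  match pselect (exists N, ~~ cont (iter N body x)) with
  | left halts => Some (iter (ex_minn halts) body x)
  | right _ => None
  end.

(* For variables with values in a countable set and measurable fibers, so that
   every [X i @^-1` A i] is an event. *)
Definition mutually_independent (d : measure_display) (T : measurableType d)
    (R : realType) (P : probability T R) (I : eqType) (S : Type)
    (X : I -> T -> S) : Prop :=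
  forall (J : seq I) (A : I -> set S), uniq J ->
    P (\bigcap_(i in [set` J]) (X i @^-1` A i)) =
    (\prod_(i <- J) P (X i @^-1` A i))%E.

(* A finite simple undirected graph on [V] is a symmetric irreflexive
   relation [e]. *)

Definition nbrs (V : finType) (e : rel V) (v : V) : {set V} :=
  [set u | e v u]%SET.

Definition deg (V : finType) (e : rel V) (v : V) : nat := #|nbrs e v|.

Section DiscountedWalk.
Context (R : realType) (V : finType) (e : rel V) (alpha : R).

(* A terminated walk from [u] is recorded as the sequence [p] of the nodes
   visited after [u], so that it terminates at [last u p].  [walk_prob u p] is
   the probability that the walk from [u] is exactly [p]. *)
Fixpoint walk_prob (u : V) (p : seq V) : R :=
  match p with
  | [::] => alpha
  | v :: p' =>
      (1 - alpha) * ((e u v)%:R / (deg e u)%:R) * walk_prob v p'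
  end.

Definition ppr (u v : V) : R :=
  fine (\esum_(p in [set p : seq V | last u p = v]) (walk_prob u p)%:E).

Definition is_walk_from (d : measure_display) (T : measurableType d)
    (P : probability T R) (u : V) (W : T -> seq V) : Prop :=
  (forall p, measurable (W @^-1` [set p])) /\
  (forall p, P (W @^-1` [set p]) = (walk_prob u p)%:E).

(* [est v] is the random estimate of [ppr v t]. *)
Definition RBS_guarantee (d : measure_display) (T : measurableType d)
    (P : probability T R) (t : V) (eps_r delta p_f : R)
    (est : V -> {RV P >-> R}) : Prop :=
  ((1 - p_f)%:E <= P [set w | forall v : V,
     ((delta <= ppr v t -> `|est v w - ppr v t| <= eps_r * ppr v t) /\
      (ppr v t < delta -> est v w <= ppr v t + delta))%R])%E.

End DiscountedWalk.

Section BackwardPush.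
Context (R : realType) (V : finType) (e : rel V) (alpha : R).

(* The pair (q, r). *)
Definition bp_init (t : V) : (V -> R) * (V -> R) :=
  (fun=> 0, fun v => (v == t)%:R).

Definition push (qr : (V -> R) * (V -> R)) (v : V) : (V -> R) * (V -> R) :=
  let: (q, r) := qr in
  (fun u => if u == v then q u + alpha * r v else q u,
   fun u => if u == v then 0
            else if u \in nbrs e v
                 then r u + (1 - alpha) * r v / (deg e u)%:R
                 else r u).

(* The values (q, r) after pushing the nodes of [h] one after the other. *)
Definition bp_values (t : V) (h : seq V) : (V -> R) * (V -> R) :=
  foldl push (bp_init t) h.

Definition bp_eligible (t : V) (rmax : R) (h : seq V) : {set V} :=
  [set v | rmax < (bp_values t h).2 v]%SET.

(* [pick h A] is the node pushed next, where [h] lists the nodes pushed so far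
   and [A] is the set of nodes whose residue exceeds the threshold.  The result
   is the list of all pushed nodes. *)
Definition backward_push (pick : seq V -> {set V} -> V) (t : V) (rmax : R) :
    option (seq V) :=
  while (fun h => bp_eligible t rmax h != finset.set0)
        (fun h => rcons h (pick h (bp_eligible t rmax h)))
        [::].

End BackwardPush.

Section AlgorithmD.
Context (R : realType) (V : finType) (e : rel V) (alpha : R) (s : V) (eps : R).

Local Notation n := (#|V|).
Local Notation d v := ((deg e v)%:R : R).

(* [est v] is the output pi'(v,s) of RBS. *)
Context (est : V -> R).

(* [pick k t] is the rule for choosing the next node in the call of
   BackwardPush on target [t] in the repetition that follows [k] completed
   ones; if the loop is left after [k] completed repetitions, the final call on
   [t] uses [pick k.+1 t]. *)
Context (pick : nat -> V -> seq V -> {set V} -> V).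

(* Cost of pushing a node, and expected cost of simulating one walk. *)
Context (push_cost : V -> R) (walk_cost : R).

Definition ppr_rough (v : V) : R :=
  if est v != 0 then est v * d v / d s else 0.

Definition candidates : {set V} :=
  [set t | 2^-1 * eps < ppr_rough t / d t]%SET.

Definition n_t : nat := `|Num.ceil (18 * ln (2 * n%:R ^+ 2) : R)|%N.

Definition n_r0 : nat := `|Num.ceil (n%:R / eps)|%N.

Definition rmax0 (t : V) : R :=
  (d t) ^+ 2 * eps ^+ 2 * n_r0%:R / (6 * ppr_rough t).

Record loop_state := LoopState {
  ls_reps : nat;
  ls_nr : nat;
  ls_rmax : V -> R }.

Definition bp_call (k : nat) (t : V) (rmax : R) : option (seq V) :=
  backward_push e alpha (pick k t) t rmax.

(* Costs are nonnegative, so a repetition is aborted as soon as its running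
   cost exceeds the budget iff its total cost does.  With positive push costs a
   diverging call exceeds any budget, hence counts as an abort. *)
Definition completes (st : loop_state) : bool :=
  let run t := bp_call (ls_reps st) t (2^-1 * ls_rmax st t) in
  [forall t in candidates, isSome (run t)] &&
  (\sum_(t in candidates) \sum_(v <- odflt [::] (run t)) push_cost v
     <= n_t%:R * (2^-1 * (ls_nr st)%:R) * walk_cost).

Definition next_state (st : loop_state) : loop_state :=
  LoopState (ls_reps st).+1 (ls_nr st)./2 (fun t => 2^-1 * ls_rmax st t).

Definition phaseII : option loop_state :=
  while completes next_state (LoopState 0 n_r0 rmax0).

(* [W i j] is the [j]-th walk available for the [i]-th estimate. *)
Context (W : nat -> nat -> seq V).

(* For [nr = 0], which the halvings may reach, the estimate is 0. *)
Definition monte_carlo (nr i : nat) (v : V) : R :=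
  (\sum_(j < nr) (last s (W i j) == v))%N%:R / nr%:R.

Definition estimate (nr i : nat) (t : V) (h : seq V) : R :=
  let: (q, r) := bp_values e alpha t h in
  q s + \sum_(v : V) monte_carlo nr i v * r v.

Definition kth_smallest (k : nat) (xs : seq R) : R :=
  nth 0 (sort <=%O xs) k.-1.

(* [None] means that no output is produced for [t].  If there is no candidate,
   phase II has nothing to compute and the output is 0 everywhere. *)
Definition algD (t : V) : option R :=
  if t \in candidates then
    match phaseII with
    | Some st =>
        match bp_call (ls_reps st).+1 t (ls_rmax st t) with
        | Some h =>
            Some (kth_smallest (uphalf n_t)
                    [seq estimate (ls_nr st) i t h | i <- iota 0 n_t])
        | None => None
        end
    | None => None
    end
  else Some 0.

End AlgorithmD.

(* Main.v *)
Require Import Defs.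
From HB Require Import structures.
From mathcomp Require Import all_boot all_order all_algebra.
From mathcomp Require Import all_classical all_reals all_analysis.
From mathcomp Require Import ring lra zify.

Set Implicit Arguments.
Unset Strict Implicit.
Unset Printing Implicit Defensive.

Import Order.TTheory GRing.Theory Num.Theory.

Local Open Scope classical_set_scope.
Local Open Scope ring_scope.

(* For a good output of RBS every candidate [t] has pi(s,t) at most twice its
   rough estimate, while pi(s,t) <= eps_d d(t) for the other nodes.  A push
   preserves pi(s,t) = q(s,t) + sum_v pi(s,v) r(v,t) (decompose walks at their
   last step), so one estimate of phase III is unbiased with variance at most
   (r_max mu - mu^2) / n_r, where mu = pi(s,t) - q(s,t).  This is at most
   (eps_d d(t))^2 / 3 in spite of the rounding in n_r := floor (n_r / 2), so an
   estimate is bad with probability at most 1/3 by Chebyshev, and the median is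
   bad with probability at most exp (- n_t / 18) <= 1 / (2 n^2).  A union bound
   over [t] leaves 1/(2n), and 1/(2n) + 1/n^2 <= 1/n because n >= 2.

   Both loops stop: a push lowers sum_v d(v) r(v,t) by more than alpha r_max,
   and once n_r = 0 the budget is 0 while a threshold below 1 forces a push.

   Given phases I and II, the output depends only on the finitely many end nodes
   of the walks, so phase III is analysed with finite sums over {ffun _}. *)

(* No measurability of [f] is needed, because the integral of a nonnegative
   function is a supremum over the simple functions below it. *)
Lemma integral_ge_on_set (d : measure_display) (T : measurableType d)
    (R : realType) (mu : {measure set T -> \bar R}) (f : T -> \bar R)
    (A : set T) (c : R) :
  measurable A -> 0 <= c -> (forall x, 0 <= f x)%E ->
  (forall x, A x -> c%:E <= f x)%E ->
  (c%:E * mu A <= \int[mu]_x f x)%E.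
Proof.
move=> mA c0 f0 fA; rewrite ge0_integralTE//; apply: ereal_sup_ubound.
exists (scale_nnsfun (indic_nnsfun R mA) c0) => /=.
  move=> x; rewrite -[X in (c * X)%:E]/(\1_A x) indicE.
  case: (boolP (x \in A)) => [/set_mem xA|_].
    by rewrite mulr1 fA.
  by rewrite mulr0 f0.
by rewrite sintegralrM sintegral_indic.
Qed.

(** * Events and laws of variables with countably many values *)

Lemma measurable_discrete (d : measure_display) (T : measurableType d)
    (S : countType) (X : T -> S) (D : set S) :
  (forall x, measurable (X @^-1` [set x])) -> measurable (X @^-1` D).
Proof.
move=> mX.
(* Numbering the values by [pickle] turns the preimage into a countable union of fibers indexed by
   natural numbers. *)
have -> : X @^-1` D = \bigcup_(k in pickle @` D) [set w | pickle (X w) = k].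
  apply/seteqP; split=> w /=.
    by move=> Dw; exists (pickle (X w)) => //=; exists (X w).
  by move=> [k [x Dx <-]] /= /(pcan_inj pickleK) ->.
apply: bigcup_measurable => k [x Dx <-].
rewrite (_ : [set w | _] = X @^-1` [set x])//.
by apply/seteqP; split=> w /= => [/(pcan_inj pickleK)|->].
Qed.

Lemma measure_discrete (d : measure_display) (T : measurableType d)
    (R : realType) (mu : {measure set T -> \bar R}) (S : countType)
    (X : T -> S) (D : set S) :
  (forall x, measurable (X @^-1` [set x])) ->
  mu (X @^-1` D) = \esum_(x in D) mu (X @^-1` [set x]).
Proof.
move=> mX.
have fibE x : [set w | pickle (X w) = pickle x] = X @^-1` [set x].
  by apply/seteqP; split=> w /= => [/(pcan_inj pickleK)|->].
have -> : X @^-1` D = \bigcup_(k in pickle @` D) [set w | pickle (X w) = k].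
  apply/seteqP; split=> w /=.
    by move=> Dw; exists (pickle (X w)) => //=; exists (X w).
  by move=> [k [x Dx <-]] /= /(pcan_inj pickleK) ->.
rewrite measure_bigcup.
- rewrite nneseries_esum// set_mem_set esum_image.
    by apply: eq_esum => x _; rewrite fibE.
  by move=> x y _ _; exact: (pcan_inj pickleK).
- by move=> k [x Dx <-]; rewrite fibE.
- by move=> k l _ _ [w [/= <- <-]].
Qed.

Lemma esum_finType (R : realType) (S : finType) (D : pred S) (a : S -> \bar R) :
  (forall x, 0 <= a x)%E ->
  \esum_(x in [set x | D x]) a x = (\sum_(x | D x) a x)%E.
Proof.
move=> a0; rewrite esum_fset//.
rewrite (fsbigE (enum D)) ?enum_uniq//.
- rewrite big_enum_cond/=; apply: eq_bigl => x.
  by rewrite mem_setE /in_mem /= andbb.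
- by move=> x /=; rewrite mem_enum.
- by move=> x /= Dx; rewrite mem_enum /in_mem /= Dx.
- exact: finite_finset.
Qed.

(** * Random walks and the law of their end nodes *)

Section WalkEndpoints.
Context (R : realType) (V : finType) (e : rel V) (alpha : R).
Context (d : measure_display) (T : measurableType d) (P : probability T R).

Lemma measurable_endpoint (u : V) (W : T -> seq V) (A : set V) :
  is_walk_from e alpha P u W -> measurable [set w | A (last u (W w))].
Proof. by move=> [mW _]; exact: (measurable_discrete [set p | A (last u p)]). Qed.

Lemma ppr_esumE (u v : V) (W : T -> seq V) : is_walk_from e alpha P u W ->
  \esum_(p in [set p | last u p = v]) (walk_prob e alpha u p)%:E =
  P [set w | last u (W w) = v].
Proof.
move=> [mW PW]; apply: esym.
rewrite (measure_discrete P [set p | last u p = v] mW).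
by apply: eq_esum => p _; exact: PW.
Qed.

(** [ppr] takes [fine] of an extended sum, which would turn infinity into 0; comparison with a
    probability excludes this. *)
Lemma ppr_fin (u v : V) (W : T -> seq V) : is_walk_from e alpha P u W ->
  (ppr e alpha u v)%:E =
  \esum_(p in [set p | last u p = v]) (walk_prob e alpha u p)%:E.
Proof.
move=> WP; rewrite /ppr fineK// (ppr_esumE _ WP) fin_num_measure//.
exact: (@measurable_endpoint _ _ [set v] WP).
Qed.

Lemma pprE (u v : V) (W : T -> seq V) : is_walk_from e alpha P u W ->
  (ppr e alpha u v)%:E = P [set w | last u (W w) = v].
Proof. by move=> WP; rewrite (ppr_fin v WP) (ppr_esumE v WP). Qed.

(** The total mass comes from the measure, since [W] has an end node at every outcome; no geometric
    series is summed. *)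
Lemma ppr_sum1 (u : V) (W : T -> seq V) : is_walk_from e alpha P u W ->
  \sum_v ppr e alpha u v = 1.
Proof.
move=> WP; apply: EFin_inj; rewrite -sumEFin.
under eq_bigr do rewrite (pprE _ WP).
rewrite -esum_finType//= set_true.
rewrite -(measure_discrete P setT (X := fun w => last u (W w))).
  by rewrite preimage_setT; exact: probability_setT.
by move=> v; exact: (@measurable_endpoint _ _ [set v] WP).
Qed.

Context (s : V) (W : nat -> nat -> T -> seq V).
Hypothesis W_walk : forall i j, is_walk_from e alpha P s (W i j).
Hypothesis W_indep : mutually_independent P (fun ij : nat * nat => W ij.1 ij.2).

Lemma prob_endpoints_eq (N M : nat) (y : {ffun 'I_N -> {ffun 'I_M -> V}}) :
  P [set w | [ffun i : 'I_N => [ffun j : 'I_M => last s (W i j w)]] = y] =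
  (\prod_i \prod_j ppr e alpha s (y i j))%:E.
Proof.
pose c (k : 'I_N * 'I_M) : nat * nat := (val k.1, val k.2).
have c_inj : injective c.
  by move=> [i j] [i' j'] [] /val_inj /= -> /val_inj /= ->.
pose J := [seq c k | k <- index_enum ('I_N * 'I_M)%type].
(* Independence asks for a set at every pair of naturals; outside the range of [c] the condition is
   vacuous and the set is full. *)
pose A ij : set (seq V) := [set p | forall k, c k = ij -> last s p = y k.1 k.2].
have AE k : A (c k) = [set p | last s p = y k.1 k.2].
  apply/seteqP; split => p /= => [|pk k' /c_inj -> //].
  by move=> /(_ k erefl).
have := W_indep A (_ : uniq J).
rewrite big_map map_inj_uniq// index_enum_uniq => /(_ isT) PJ.
rewrite pair_bigA -prodEFin /=.
transitivity (\prod_k P [set w | last s (W (c k).1 (c k).2 w) = y k.1 k.2])%E;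
  last first.
  by apply: eq_bigr => k _; rewrite -(pprE _ (W_walk _ _)).
transitivity (P (\bigcap_(i in [set` J])
    ((fun ij : nat * nat => W ij.1 ij.2) i @^-1` A i))); last first.
  rewrite PJ; apply: eq_bigr => k _; congr (P _).
  by rewrite AE.
congr (P _); apply/seteqP; split => w /=.
  by move=> yE _ /= /mapP[k _ ->]; rewrite AE /= -yE !ffunE.
move=> wA; apply/ffunP => i; apply/ffunP => j; rewrite !ffunE.
have /= := wA (c (i, j)); rewrite AE /=; apply.
by apply: map_f; rewrite mem_index_enum.
Qed.

Lemma measurable_endpoints (N M : nat)
    (Q : set {ffun 'I_N -> {ffun 'I_M -> V}}) :
  measurable [set w | Q [ffun i : 'I_N => [ffun j : 'I_M => last s (W i j w)]]].
Proof.
apply: (measurable_discrete Q) => y.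
rewrite (_ : _ @^-1` _ = \bigcap_(i in [set: 'I_N]) \bigcap_(j in [set: 'I_M])
  [set w | last s (W i j w) = y i j]); last first.
  apply/seteqP; split => w /=.
    by move=> <- i _ j _ /=; rewrite !ffunE.
  move=> wy; apply/ffunP => i; apply/ffunP => j; rewrite !ffunE.
  exact: (wy i Logic.I j Logic.I).
apply: fin_bigcap_measurable => // i _; apply: fin_bigcap_measurable => // j _.
exact: (@measurable_endpoint _ _ [set y i j] (W_walk i j)).
Qed.

Lemma prob_endpoints (N M : nat) (Q : pred {ffun 'I_N -> {ffun 'I_M -> V}}) :
  P [set w | Q [ffun i : 'I_N => [ffun j : 'I_M => last s (W i j w)]]] =
  (\sum_(y | Q y) \prod_i \prod_j ppr e alpha s (y i j))%:E.
Proof.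
pose X w := [ffun i : 'I_N => [ffun j : 'I_M => last s (W i j w)]].
rewrite (measure_discrete P [set y | Q y] (X := X)); last first.
  by move=> y; exact: (measurable_endpoints [set y]).
rewrite esum_finType// -sumEFin; apply: eq_bigr => y _.
exact: prob_endpoints_eq.
Qed.

End WalkEndpoints.

(** * Finite product distributions: Chebyshev and Chernoff bounds *)

Section ProductDistribution.
Context (R : realType) (S : finType) (m : S -> R).
Hypothesis m_ge0 : forall v, 0 <= m v.
Hypothesis m_sum1 : \sum_v m v = 1.

Lemma sum_prod_ffun (I : finType) (F : I -> S -> R) :
  \sum_(y : {ffun I -> S}) \prod_i F i (y i) = \prod_i \sum_v F i v.
Proof. by rewrite bigA_distr_bigA. Qed.

Lemma sum_prod_ffun1 (I : finType) :
  \sum_(y : {ffun I -> S}) \prod_i m (y i) = 1.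
Proof.
by rewrite (sum_prod_ffun (fun=> m)) big1.
Qed.

Lemma prod_single (I : finType) (k : I) (F : I -> R) :
  \prod_i (if i == k then F i else 1) = F k.
Proof. by rewrite -big_mkcond /= big_pred1_eq. Qed.

Lemma product_cross_moment (I : finType) (g : S -> R) (j k : I) :
  \sum_v m v * g v = 0 ->
  \sum_(y : {ffun I -> S}) (\prod_i m (y i)) * (g (y j) * g (y k)) =
  (j == k)%:R * \sum_v m v * g v ^+ 2.
Proof.
move=> g0.
(* Both factors [g] are absorbed into the coordinates, so the sum factorizes; for distinct [j] and
   [k] the factor at [j] is the mean of [g], which is 0. *)
pose F i v := m v * ((if i == j then g v else 1) * (if i == k then g v else 1)).
rewrite (eq_bigr (fun y : {ffun I -> S} => \prod_i F i (y i))); last first.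
  move=> y _; rewrite /F !big_split /=.
  by rewrite (prod_single j (fun i => g (y i))) (prod_single k (fun i => g (y i))).
rewrite sum_prod_ffun; case: (eqVneq j k) => [jk|jk].
  rewrite mul1r (bigD1 j)//= [X in _ * X]big1 ?mulr1; last first.
    by move=> i ij; rewrite -[RHS]m_sum1; apply: eq_bigr => v _;
       rewrite /F -jk (negbTE ij) !mulr1.
  by apply: eq_bigr => v _; rewrite /F -jk eqxx expr2.
rewrite mul0r (bigD1 j)//= [X in X * _](_ : _ = 0) ?mul0r//.
rewrite -[RHS]g0; apply: eq_bigr => v _.
by rewrite /F eqxx (negbTE jk) mulr1.
Qed.

(** For independent centered variables only the diagonal terms of the expanded square survive. *)
Lemma product_second_moment (I : finType) (g : S -> R) :
  \sum_v m v * g v = 0 ->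
  \sum_(y : {ffun I -> S}) (\prod_i m (y i)) * (\sum_i g (y i)) ^+ 2 =
  #|I|%:R * \sum_v m v * g v ^+ 2.
Proof.
move=> g0.
transitivity (\sum_(j : I) \sum_(k : I)
   \sum_(y : {ffun I -> S}) (\prod_i m (y i)) * (g (y j) * g (y k))).
  rewrite -(eq_bigr _ (fun j _ => exchange_big _ _ _ _ _ _)) exchange_big /=.
  apply: eq_bigr => y _; rewrite expr2 mulr_suml mulr_sumr.
  by apply: eq_bigr => j _; rewrite !mulr_sumr.
under eq_bigr => j _.
  under eq_bigr => k _ do rewrite product_cross_moment//.
  rewrite -mulr_suml (bigD1 j)//= eqxx big1 ?addr0 ?mul1r; last first.
    by move=> k kj; rewrite eq_sym (negbTE kj).
  over.
by rewrite sumr_const mulr_natl.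
Qed.

Lemma product_chebyshev (I : finType) (g : S -> R) (c : R) : 0 < c ->
  \sum_v m v * g v = 0 ->
  \sum_(y : {ffun I -> S} | c < `|\sum_i g (y i)|) \prod_i m (y i) <=
  #|I|%:R * (\sum_v m v * g v ^+ 2) / c ^+ 2.
Proof.
move=> c0 g0; rewrite -product_second_moment// mulr_suml big_mkcond /=.
apply: ler_sum => y _.
have m0 : 0 <= \prod_i m (y i) by apply: prodr_ge0.
case: ifPn => cg; last by rewrite mulr_ge0 ?invr_ge0 ?sqr_ge0// mulr_ge0 ?sqr_ge0.
rewrite -mulrA ler_peMr// ler_pdivlMr ?exprn_gt0// mul1r.
rewrite -[leRHS]real_normK ?num_real//.
by rewrite lerXn2r ?nnegrE// ltW.
Qed.

(* Chernoff: [sqrt 2 ^ (2 * #bad - N)] dominates the indicator of the event and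
   has expectation [((1 + p) / sqrt 2) ^ N] when each coordinate is bad with
   probability [p <= 1/3]. *)
Lemma product_majority (N : nat) (bad : pred S) :
  \sum_(v | bad v) m v <= 3^-1 ->
  \sum_(y : {ffun 'I_N -> S} | (N <= (\sum_i bad (y i)).*2)%N)
     \prod_i m (y i) <= expR (- (N%:R / 18)).
Proof.
move=> p3; pose q : R := Num.sqrt 2.
have q0 : 0 < q by rewrite sqrtr_gt0.
have qq : q * q = 2 by rewrite -expr2 sqr_sqrtr.
pose F (v : S) : R := m v * (if bad v then q else q^-1).
apply: (@le_trans _ _ (\sum_(y : {ffun 'I_N -> S}) \prod_i F (y i))).
  rewrite big_mkcond /=; apply: ler_sum => y _.
  rewrite /F big_split /=.
  have m0 : 0 <= \prod_i m (y i) by apply: prodr_ge0.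
  case: ifPn => [big_bad|_]; last first.
    apply: mulr_ge0 => //; apply: prodr_ge0 => i _.
    by case: ifP; rewrite ?invr_ge0 ltW.
  rewrite ler_peMr//.
  have -> : \prod_(i < N) (if bad (y i) then q else q^-1) =
      \prod_(i < N) (q^-1 * q ^+ (bad (y i)).*2).
    apply: eq_bigr => i _; case: (bad _); rewrite /= ?expr0 ?mulr1//.
    by rewrite expr2 mulrA mulVf ?mul1r// gt_eqF.
  rewrite big_split /= prodr_const card_ord prodrXr.
  have -> : (\sum_(i < N) (bad (y i)).*2 = (\sum_i bad (y i)).*2)%N.
    by rewrite -!mul2n big_distrr /=; apply: eq_bigr => i _; rewrite mul2n.
  rewrite -(subnKC big_bad) exprD mulrA exprVn mulVf ?mul1r; last first.
    by rewrite expf_neq0// gt_eqF.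
  rewrite exprn_ege1// -(@ler_pXn2r _ 2)// ?nnegrE ?(ltW q0)//.
  by rewrite expr1n expr2 qq ler1n.
rewrite (sum_prod_ffun (fun=> F)) prodr_const card_ord.
rewrite -mulrN [leRHS]expRM_natl.
have F0 : 0 <= \sum_v F v.
  by apply: sumr_ge0 => v _; rewrite mulr_ge0//; case: ifP; rewrite ?invr_ge0 ltW.
apply: lerXn2r; rewrite ?nnegrE ?expR_ge0//.
have qV : q^-1 = q / 2.
  by apply: (mulfI (lt0r_neq0 q0)); rewrite mulfV ?gt_eqF// mulrA qq divff.
have FE : \sum_v F v = q / 2 * (1 + \sum_(v | bad v) m v).
  have qm : \sum_v q / 2 * m v = q / 2 by rewrite -mulr_sumr m_sum1 mulr1.
  rewrite mulrDr mulr1 -[X in X + _]qm !mulr_sumr [X in _ + X]big_mkcond /=.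
  rewrite -big_split /=; apply: eq_bigr => v _.
  by rewrite /F qV; case: ifP => _; field.
have Fle : \sum_v F v <= 2 / 3 * q.
  rewrite FE; nra.
apply: (le_trans Fle).
have q23 : 0 <= 2 / 3 * q by nra.
(* After squaring, the claim is 8/9 <= exp(-1/9), an instance of 1 + x <= exp x; this is where 18
   comes from. *)
rewrite -(@ler_pXn2r _ 2)// ?nnegrE ?expR_ge0//.
rewrite -expRM_natl exprMn [q ^+ 2]expr2 qq.
apply: le_trans (expR_ge1Dx _).
by lra.
Qed.

End ProductDistribution.

(** * Deviation of the median *)

Lemma median_deviation (R : realType) (N : nat) (f : 'I_N -> R) (a c : R) :
  (0 < N)%N -> ((\sum_i (c < `|f i - a|)%R).*2 < N)%N ->
  `|kth_smallest (uphalf N) [seq f i | i <- enum 'I_N] - a| <= c.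
Proof.
move=> N0; set xs := [seq f i | i <- enum 'I_N]; move=> few.
have szN : size (sort <=%O xs) = N by rewrite size_sort size_map size_enum_ord.
have cnt (p : pred R) : (forall i, p (f i) -> c < `|f i - a|) ->
    ((count p (sort <=%O xs)).*2 < N)%N.
  move=> pc; apply: leq_ltn_trans few; rewrite leq_double.
  rewrite (permP (permEl (perm_sort _ _))) count_map -sum1_count.
  rewrite big_mkcond big_enum /=.
  by apply: leq_sum => i _ /=; case: ifP => // /pc ->.
set k := (uphalf N).-1.
have kN : (k < N)%N.
  by rewrite /k prednK ?uphalf_gt0// leq_uphalf_double -addnn leq_addr.
have srt : sorted <=%O (sort <=%O xs) by exact: sort_le_sorted.
have mono i j : (i <= j)%N -> (j < N)%N ->
    nth 0 (sort <=%O xs) i <= nth 0 (sort <=%O xs) j.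
  move=> ij jN; apply: (sorted_leq_nth le_trans le_refl 0 srt) => //;
   rewrite inE szN//; exact: leq_ltn_trans jN.
have upN : (N <= (uphalf N).*2)%N by rewrite -leq_uphalf_double.
rewrite ler_distl /kth_smallest -/k; apply/andP; split.
  (* A median that is too small makes the first [uphalf N] sorted entries bad, at least half of
     all. *)
  rewrite leNgt; apply/negP => low.
  have pc i : f i < a - c -> c < `|f i - a|.
    by move=> fi; rewrite distrC ltr_normr; apply/orP; left; lra.
  have := cnt (fun x => x < a - c) pc.
  rewrite -(cat_take_drop (uphalf N) (sort _ _)) count_cat ltnNge => /negP; apply.
  apply: (leq_trans upN); rewrite leq_double; apply: leq_trans (leq_addr _ _).
  have szt : size (take (uphalf N) (sort <=%O xs)) = uphalf N.
    by rewrite size_takel// szN; move: kN; rewrite /k prednK ?uphalf_gt0.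
  rewrite -[leqLHS]szt; set l := take _ _.
  have := all_count (fun x => x < a - c) l.
  suff -> : all (fun x => x < a - c) l by move=> /esym/eqP ->.
  apply/(all_nthP 0) => i; rewrite szt => iN.
  rewrite nth_take//; apply: le_lt_trans low; apply: mono => //.
  by rewrite -ltnS /k prednK ?uphalf_gt0.
rewrite leNgt; apply/negP => high.
have pc i : a + c < f i -> c < `|f i - a|.
  by move=> fi; rewrite ltr_normr; apply/orP; left; lra.
have := cnt (fun x => a + c < x) pc.
rewrite -(cat_take_drop k (sort _ _)) count_cat ltnNge => /negP; apply.
(* A median that is too large makes the [N - k] entries from index [k] on bad; these are also at
   least half, because [k] is [uphalf N] minus 1 and twice [uphalf N] is at most [N.+1]. *)
apply: (@leq_trans (N - k).*2).
  have : ((uphalf N).*2 <= N.+1)%N.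
    by rewrite -[leqLHS]/((N.+1)./2.*2) halfK; exact: leq_subr.
  have : (uphalf N = k.+1)%N by rewrite prednK ?uphalf_gt0.
  by move=> -> ?; lia.
rewrite leq_double; apply: leq_trans (leq_addl _ _).
have szt : size (drop k (sort <=%O xs)) = (N - k)%N by rewrite size_drop szN.
rewrite -[leqLHS]szt; set l := drop _ _.
have := all_count (fun x => a + c < x) l.
suff -> : all (fun x => a + c < x) l by move=> /esym/eqP ->.
apply/(all_nthP 0) => i; rewrite szt => iN.
rewrite nth_drop; apply: lt_le_trans high _; apply: mono; first exact: leq_addr.
by rewrite -ltn_subRL.
Qed.

(** * Walk probabilities: reversal and last step *)

Lemma esumZl (R : realType) (T : choiceType) (I : set T) (a : T -> \bar R)
    (c : R) : 0 <= c -> (forall i, 0 <= a i)%E ->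
  \esum_(i in I) (c%:E * a i)%E = (c%:E * \esum_(i in I) a i)%E.
Proof.
move=> c0 a0; rewrite /esum -ereal_supZl//; last first.
  by apply/set0P; exists 0%E; exists set0; [exact: fsets_set0|rewrite fsbig_set0].
congr ereal_sup; apply/seteqP; split => [_ [X XI <-]|_ [_ [X XI <-] <-]].
  by exists (\sum_(i \in X) a i)%E; [exists X|rewrite ge0_mule_fsumr].
by exists X => //; rewrite ge0_mule_fsumr.
Qed.

Section WalkProbability.
Context (R : realType) (V : finType) (e : rel V) (alpha : R).
Local Notation d v := ((deg e v)%:R : R).

Definition step_prob (u v : V) : R := (1 - alpha) * ((e u v)%:R / d u).

(** The recursion of [walk_prob] splits off the first step, whereas Backward Push needs the last
    one. *)
Lemma walk_prob_rcons (u v : V) (p : seq V) :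
  walk_prob e alpha u (rcons p v) =
  walk_prob e alpha u p * step_prob (last u p) v.
Proof.
elim: p u => [|w p IH] u /=; first by rewrite mulrC.
by rewrite IH mulrA.
Qed.

(** [rev (belast u p)] encodes the reversed walk: it starts at [last u p] and, as the encoding
    demands, omits its start. *)
Lemma last_rev_belast (u : V) (p : seq V) :
  last (last u p) (rev (belast u p)) = u.
Proof. by case: p => [|v p] //=; rewrite rev_cons last_rcons. Qed.

Lemma rev_belast_rev_belast (u : V) (p : seq V) :
  rev (belast (last u p) (rev (belast u p))) = p.
Proof.
case: p => [|v p] //=; rewrite rev_cons belast_rcons /= rev_cons revK.
by rewrite -lastI.
Qed.

Hypothesis e_sym : symmetric e.
Hypothesis deg_ge1 : forall v, (1 <= deg e v)%N.
Hypothesis alpha_gt0 : 0 < alpha.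
Hypothesis alpha_lt1 : alpha < 1.

Lemma deg_gt0 v : 0 < d v. Proof. by rewrite ltr0n. Qed.

Lemma step_prob_ge0 u v : 0 <= step_prob u v.
Proof. by apply: mulr_ge0; [rewrite subr_ge0 ltW|rewrite divr_ge0]. Qed.

Lemma walk_prob_ge0 u p : 0 <= walk_prob e alpha u p.
Proof.
elim: p u => [|v p IH] u /=; first exact: ltW.
by rewrite mulr_ge0// step_prob_ge0.
Qed.

(** Detailed balance: d(u) times the step probability from u to v is symmetric because [e] is, and
    this telescopes along the walk. *)
Lemma walk_prob_rev (u : V) (p : seq V) :
  d u * walk_prob e alpha u p =
  d (last u p) * walk_prob e alpha (last u p) (rev (belast u p)).
Proof.
elim: p u => [|v p IH] u //=.
rewrite rev_cons walk_prob_rcons last_rev_belast mulrA -IH /step_prob e_sym.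
have du := deg_gt0 u; have dv := deg_gt0 v.
by field; rewrite !gt_eqF.
Qed.

Local Notation pi_esum u v :=
  (\esum_(p in [set p : seq V | last u p = v]) (walk_prob e alpha u p)%:E).

(** Reversal is a bijection between the walks from [v] to [u] and those from [u] to [v]. *)
Lemma ppr_esum_rev (u v : V) : ((d u)%:E * pi_esum u v = (d v)%:E * pi_esum v u)%E.
Proof.
rewrite -!esumZl// => [|p|p]; rewrite ?lee_fin ?walk_prob_ge0//.
rewrite (@reindex_esum _ _ _ [set p | last v p = u] _
  (fun p => rev (belast v p))); last first.
  split.
  - by move=> p /= <-; rewrite last_rev_belast.
  - move=> p p' /set_mem /= pu /set_mem /= p'u /(congr1 (fun q => rev (belast u q))).
    by rewrite -{1}pu -p'u !rev_belast_rev_belast.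
  - move=> p /= pv; exists (rev (belast u p)) => /=; rewrite -pv.
      exact: last_rev_belast.
    exact: rev_belast_rev_belast.
apply: eq_esum => p /= pu; rewrite -!EFinM; congr (_%:E).
by rewrite (walk_prob_rev v) pu.
Qed.

(** Given walks from [s] only, finiteness is known in one direction; [ppr_esum_rev] transfers it to
    the other. *)
Lemma ppr_rev (u v : V) : pi_esum u v \is a fin_num ->
  d u * ppr e alpha u v = d v * ppr e alpha v u.
Proof.
move=> fin_uv.
have vuE : pi_esum v u = (((d v)^-1 * d u)%:E * pi_esum u v)%E.
  rewrite EFinM -muleA ppr_esum_rev muleA -EFinM mulVf ?mul1e//.
  by rewrite gt_eqF// deg_gt0.
rewrite /ppr vuE -(fineK fin_uv) -EFinM /= !mulrA.
by rewrite divff ?mul1r// gt_eqF// deg_gt0.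
Qed.

(** A walk ending at [v] is empty or extends a walk ending at some [w] by a step from [w] to [v]. *)
Lemma ppr_esum_last (u v : V) :
  pi_esum u v = ((alpha * (u == v)%:R)%:E +
    \sum_w (step_prob w v)%:E * pi_esum u w)%E.
Proof.
have w0 p : (0 <= (walk_prob e alpha u p)%:E)%E by rewrite lee_fin walk_prob_ge0.
rewrite (esumID [set [::]])//; congr (_ + _)%E.
  have [uv|uv] := eqVneq u v.
    rewrite (_ : _ `&` _ = [set [::]]) ?esum_set1 ?mulr1//.
    by apply/seteqP; split => p /= => [[]|->].
  rewrite mulr0 esum1// => p /= [+ pnil]; rewrite pnil /= => uv'.
  by rewrite uv' eqxx in uv.
rewrite (_ : _ `&` _ = (rcons^~ v) @` setT); last first.
  apply/seteqP; split => p /=.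
    case/lastP: p => [|p w] [] //; rewrite last_rcons => -> _; by exists p.
  by move=> [q _ <-]; rewrite last_rcons; split => //; case: q.
rewrite esum_image; last by move=> p q _ _ /rcons_inj[].
under eq_bigr do rewrite -esumZl ?step_prob_ge0//.
under [RHS]eq_bigr do rewrite esum_mkcond.
rewrite -esum_sum; last first.
  by move=> p w _ _; case: ifP => // _; rewrite mule_ge0// lee_fin step_prob_ge0.
apply: eq_esum => p _; rewrite walk_prob_rcons (bigD1 (last u p))//=.
rewrite ifT ?inE// big1 ?adde0 -?EFinM 1?mulrC// => w wp.
by rewrite ifF//; apply/negP => /set_mem /= pw; rewrite pw eqxx in wp.
Qed.

Lemma ppr_last (u v : V) : (forall w, pi_esum u w \is a fin_num) ->
  ppr e alpha u v =
  alpha * (u == v)%:R + \sum_w step_prob w v * ppr e alpha u w.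
Proof.
move=> fin; apply: EFin_inj; rewrite EFinD -sumEFin.
under eq_bigr do rewrite EFinM /ppr fineK//.
by rewrite /ppr fineK// ppr_esum_last.
Qed.

End WalkProbability.

(** * While loops; invariant and termination of Backward Push *)

Lemma whileP (T : Type) (cont : T -> bool) (body : T -> T) (x : T) :
  (exists N, ~~ cont (iter N body x)) ->
  exists N, while cont body x = Some (iter N body x) /\ ~~ cont (iter N body x).
Proof.
move=> halts; rewrite /while; case: pselect => // halts'.
by exists (ex_minn halts'); split => //; case: ex_minnP.
Qed.

Section BackwardPushTheory.
Context (R : realType) (V : finType) (e : rel V) (alpha : R).
Local Notation d v := ((deg e v)%:R : R).
Hypothesis e_sym : symmetric e.
Hypothesis e_irr : irreflexive e.
Hypothesis deg_ge1 : forall v, (1 <= deg e v)%N.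
Hypothesis alpha_gt0 : 0 < alpha.
Hypothesis alpha_lt1 : alpha < 1.

Local Notation values t h := (bp_values e alpha t h).

Lemma bp_values_rcons t h v : values t (rcons h v) = push e alpha (values t h) v.
Proof. by rewrite /bp_values foldl_rcons. Qed.

(** One linear formula replaces the cases of [push]; at [u = v] it gives 0 because [e] has no
    loops. *)
Lemma push_residueE (qr : (V -> R) * (V -> R)) v u :
  (push e alpha qr v).2 u =
  qr.2 u + qr.2 v * (step_prob e alpha u v - (u == v)%:R).
Proof.
case: qr => q r /=; rewrite /step_prob.
have [->|uv] := eqVneq u v; first by rewrite e_irr /=; ring.
rewrite inE e_sym; case: (e u v) => /=; last by ring.
by field; rewrite gt_eqF// deg_gt0.
Qed.

Lemma bp_residue_ge0 t h v : 0 <= (values t h).2 v.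
Proof.
elim/last_ind: h v => [|h v IH] u; first by rewrite /= ler0n.
rewrite bp_values_rcons; move: IH; case: (values t h) => q r /= r0.
case: ifP => // _; case: ifP => // _; rewrite addr_ge0//.
by rewrite divr_ge0// mulr_ge0// subr_ge0 ltW.
Qed.

Lemma bp_reserve_ge0 t h v : 0 <= (values t h).1 v.
Proof.
elim/last_ind: h v => [|h v IH] u //.
rewrite bp_values_rcons; move: IH (bp_residue_ge0 t h v).
case: (values t h) => q r /= q0 rv0.
by case: ifP => // _; rewrite addr_ge0// mulr_ge0// ltW.
Qed.

(** [c] stands for pi(s, .), of which only the last-step recursion matters: the residue taken from
    [v] has weight [c v], exactly what the shares of the neighbors and, if [v = s], the reserve get
    back. *)
Lemma bp_invariant (c : V -> R) (s t : V) (h : seq V) :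
  (forall v, c v = alpha * (s == v)%:R + \sum_w step_prob e alpha w v * c w) ->
  c t = (values t h).1 s + \sum_v c v * (values t h).2 v.
Proof.
move=> cE; elim/last_ind: h => [|h v IH].
  rewrite add0r (bigD1 t)//= eqxx mulr1 big1 ?addr0// => v /negbTE ->.
  by rewrite mulr0.
rewrite bp_values_rcons (eq_bigr _ (fun u _ => congr1 _ (push_residueE _ _ _))).
rewrite {}IH; case: (values t h) => q r /=.
have -> : (if s == v then q s + alpha * r v else q s) =
    q s + r v * (alpha * (s == v)%:R).
  by case: (s == v) => /=; ring.
rewrite -addrA; congr (_ + _).
under [in RHS]eq_bigr do rewrite mulrDr mulrCA.
rewrite big_split /= addrCA -mulr_sumr -mulrDr.
rewrite [X in _ = _ + _ * X](_ : _ = 0) ?mulr0 ?addr0//.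
under eq_bigr do rewrite mulrBr [c _ * step_prob _ _ _ _]mulrC.
rewrite sumrB addrA -cE (bigD1 v)//= eqxx mulr1 big1 ?addr0 ?subrr//.
by move=> u /negbTE ->; rewrite mulr0.
Qed.

(** Weighting by degree cancels the division by d(u) in a push: the neighbors of v receive (1 -
    alpha) d(v) r(v) in total, so alpha d(v) r(v) is lost. *)
Definition bp_potential (r : V -> R) : R := \sum_v d v * r v.

Lemma bp_potential_push (qr : (V -> R) * (V -> R)) v :
  bp_potential (push e alpha qr v).2 =
  bp_potential qr.2 - alpha * (d v * qr.2 v).
Proof.
rewrite /bp_potential; under eq_bigr do rewrite push_residueE mulrDr mulrCA.
rewrite big_split /= -mulr_sumr; congr (_ + _).
under eq_bigr do rewrite mulrBr.
rewrite sumrB [X in _ - X](_ : _ = d v); last first.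
  rewrite (bigD1 v)//= eqxx mulr1 big1 ?addr0//.
  by move=> u /negbTE ->; rewrite mulr0.
rewrite [X in X - _](_ : _ = (1 - alpha) * d v); first by ring.
have -> : d v = \sum_u (e v u)%:R.
  rewrite /deg -sum1_card natr_sum big_mkcond /=.
  by apply: eq_bigr => u _; rewrite inE; case: (e v u).
rewrite mulr_sumr; apply: eq_bigr => u _; rewrite /step_prob e_sym.
by field; rewrite gt_eqF// deg_gt0.
Qed.

Lemma backward_pushP (pick : seq V -> {set V} -> V) (t : V) (rmax : R) :
  (forall h A, A != finset.set0 -> pick h A \in A) -> 0 < rmax ->
  exists2 h, backward_push e alpha pick t rmax = Some h &
    forall v, (values t h).2 v <= rmax.
Proof.
move=> pick_in rmax0.
pose body h := rcons h (pick h (bp_eligible e alpha t rmax h)).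
pose cont h := bp_eligible e alpha t rmax h != finset.set0.
have halts : exists N, ~~ cont (iter N body [::]).
  apply: contrapT => /forallNP run.
  have run' N : cont (iter N body [::]) by apply: contrapT => /negP /run.
  have ar0 : 0 < alpha * rmax by rewrite mulr_gt0.
  have bound N : bp_potential (values t (iter N body [::])).2 <=
      bp_potential (values t [::]).2 - N%:R * (alpha * rmax).
    elim: N => [|N IH]; first by rewrite mul0r subr0.
    rewrite iterS bp_values_rcons bp_potential_push -natr1 mulrDl mul1r opprD addrA.
    apply: lerD => //; rewrite lerN2 ler_pM2l//.
    have /pick_in := run' N; move/(_ (iter N body [::])).
    set v := pick _ _; rewrite inE => rv.
    apply: (le_trans (ltW rv)); rewrite ler_peMl ?bp_residue_ge0//.
    by rewrite ler1n.
  (* By the Archimedean property this many pushes would make the potential negative. *)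
  set N := (Num.bound (bp_potential (values t [::]).2 / (alpha * rmax))).
  have := bound N; apply/negP; rewrite -ltNge.
  apply: (@lt_le_trans _ _ 0); last first.
    by apply: sumr_ge0 => v _; rewrite mulr_ge0// bp_residue_ge0.
  rewrite subr_lt0 -ltr_pdivrMr// /N archi_boundP//.
  apply: divr_ge0; last exact: ltW.
  by apply: sumr_ge0 => v _; rewrite mulr_ge0// bp_residue_ge0.
have [N [bpE]] := whileP halts; rewrite negbK => /eqP el0.
exists (iter N body [::]) => // v.
have : v \notin bp_eligible e alpha t rmax (iter N body [::]) by rewrite el0 inE.
by rewrite inE -leNgt.
Qed.

End BackwardPushTheory.

(** * Phase II: loop states and termination *)

Section PhaseII.
Context (R : realType) (V : finType) (e : rel V) (alpha : R) (s : V) (eps : R).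
Local Notation d v := ((deg e v)%:R : R).
Hypothesis e_sym : symmetric e.
Hypothesis e_irr : irreflexive e.
Hypothesis deg_ge1 : forall v, (1 <= deg e v)%N.
Hypothesis alpha_gt0 : 0 < alpha.
Hypothesis alpha_lt1 : alpha < 1.
Hypothesis eps_gt0 : 0 < eps.
Context (est : V -> R) (pick : nat -> V -> seq V -> {set V} -> V).
Hypothesis pick_in : forall k t h A, A != finset.set0 -> pick k t h A \in A.
Context (push_cost : V -> R) (walk_cost : R).
Hypothesis push_cost_gt0 : forall v, 0 < push_cost v.

Local Notation rough := (ppr_rough e s est).
Local Notation cand := (candidates e s eps est).

(** Repeated floor-halving is a single floor division by [2 ^ k], while the thresholds are halved
    exactly; this mismatch is the rounding that [residue_variance_bound] absorbs. *)
Definition state_after (k : nat) : loop_state R V :=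
  LoopState k (n_r0 V eps %/ 2 ^ k) (fun t => rmax0 e s eps est t / 2 ^+ k).

Lemma iter_next_state k :
  iter k (@next_state R V) (LoopState 0 (n_r0 V eps) (rmax0 e s eps est)) =
  state_after k.
Proof.
elim: k => [|k IH].
  rewrite /state_after expn0 divn1 /=; congr LoopState.
  by apply/funext => t; rewrite expr0 divr1.
rewrite iterS IH /next_state /state_after /=; congr LoopState.
  by rewrite -divn2 -divnMA expnSr.
by apply/funext => t; rewrite exprS invfM mulrCA.
Qed.

Lemma ppr_roughE v : rough v = est v * d v / d s.
Proof. by rewrite /ppr_rough; case: eqVneq => // ->; rewrite !mul0r. Qed.

Lemma rough_gt t : t \in cand -> eps * d t / 2 < rough t.
Proof.
rewrite inE ltr_pdivlMr ?deg_gt0// => lt_rough.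
by apply: le_lt_trans lt_rough; rewrite mulrC mulrA.
Qed.

Lemma rough_gt0 t : t \in cand -> 0 < rough t.
Proof.
move=> /rough_gt; apply: lt_trans.
by rewrite divr_gt0// mulr_gt0// deg_gt0.
Qed.

Lemma rmax_state_gt0 k t : t \in cand -> 0 < ls_rmax (state_after k) t.
Proof.
move=> tC /=; have nr0 : (0 < n_r0 V eps)%N.
  rewrite absz_gt0 gt_eqF// ceil_gt0 divr_gt0// ltr0n.
  by apply/card_gt0P; exists s.
apply: divr_gt0; last exact: exprn_gt0.
apply: divr_gt0; last by apply: mulr_gt0 => //; exact: rough_gt0.
apply: mulr_gt0; last by rewrite ltr0n.
by apply: mulr_gt0; apply: exprn_gt0 => //; exact: deg_gt0.
Qed.

Lemma bp_call_state k j t c : t \in cand -> 0 < c ->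
  exists2 h, bp_call e alpha pick j t (c * ls_rmax (state_after k) t) = Some h &
    forall v, (bp_values e alpha t h).2 v <= c * ls_rmax (state_after k) t.
Proof.
move=> tC c0; apply: backward_pushP => // [h A|]; first exact: pick_in.
by rewrite mulr_gt0// rmax_state_gt0.
Qed.

(** Without candidates every repetition would cost 0 and, for a nonnegative [walk_cost], stay within
    the budget forever. *)
Lemma phaseIIP : cand != finset.set0 ->
  exists k, phaseII e alpha s eps est pick push_cost walk_cost =
            Some (state_after k).
Proof.
move=> /finset.set0Pn[t tC]; rewrite /phaseII.
have [|N [-> _]] := @whileP _ (completes e alpha s eps est pick push_cost walk_cost)
  (@next_state R V) (LoopState 0 (n_r0 V eps) (rmax0 e s eps est)); last first.
  by exists N; rewrite iter_next_state.
(* [2 ^ k] exceeds both initial values, so the number of walks and the budget are 0 and the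
   threshold of [t] is below 1. *)
pose k := (n_r0 V eps + Num.bound (rmax0 e s eps est t))%N.
exists k; rewrite iter_next_state /completes negb_and -implybE; apply/implyP => _.
have nr0 : ls_nr (state_after k) = 0%N.
  rewrite /= divn_small//; apply: leq_ltn_trans (ltn_expl k _) => //.
  exact: leq_addr.
rewrite nr0 !(mulr0, mul0r) -ltNge.
have half0 : 0 < 2^-1 :> R by rewrite invr_gt0.
have [h hE hle] := bp_call_state k (ls_reps (state_after k)) tC half0.
have cost_ge0 (l : seq V) : 0 <= \sum_(v <- l) push_cost v.
  by apply: sumr_ge0 => v _; exact: ltW.
rewrite (bigD1 t)//= ltr_pwDl//; last by apply: sumr_ge0.
rewrite hE /=; case: h hle {hE} => [|v h] hle; last first.
  by rewrite big_cons ltr_pwDl.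
(* Without a push the residue of [t] would still be 1, above half the threshold. *)
have /= := hle t; rewrite eqxx mulr1n leNgt => /negP[].
have rm0 : 0 < rmax0 e s eps est t / 2 ^+ k by exact: (rmax_state_gt0 k tC).
have : rmax0 e s eps est t / 2 ^+ k < 1.
  rewrite ltr_pdivrMr ?exprn_gt0// mul1r.
  apply: (lt_trans (archi_boundP _)).
    by move: rm0; rewrite pmulr_lgt0 ?invr_gt0 ?exprn_gt0// => /ltW.
  rewrite -natrX ltr_nat; apply: leq_ltn_trans (ltn_expl k _) => //.
  exact: leq_addl.
by lra.
Qed.

End PhaseII.

(** * Failure probability of a single estimate *)

Section OneEstimate.
Context (R : realType).

(* [D = eps d(t)] and [z] is the threshold [D^2 x / (6 rho)], where [x] is the
   unrounded number of walks; although [x] may be as large as [N + 1], the term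
   [- mu ^+ 2] absorbs the rounding. *)
Lemma residue_variance_bound (D rho mu x z : R) (N : nat) :
  0 < D -> D / 2 < rho -> 0 <= mu -> mu <= 2 * rho -> 0 <= x ->
  x < N%:R + 1 -> (0 < N)%N -> z = D ^+ 2 * x / (6 * rho) ->
  z * mu - mu ^+ 2 <= N%:R * D ^+ 2 / 3.
Proof.
move=> D0 Drho mu0 mu_rho x0 xN N0 zE.
have rho0 : 0 < rho by lra.
have zrho : z * rho = D ^+ 2 * x / 6 by rewrite zE; field; rewrite gt_eqF.
have z0 : 0 <= z.
  by rewrite zE divr_ge0 ?mulr_ge0 ?sqr_ge0//; lra.
have N1 : 1 <= N%:R :> R by rewrite ler1n.
have D2 : 0 < D ^+ 2 by rewrite exprn_gt0.
have [muD|Dmu] := leP mu D.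
  have zD : z <= D * x / 3.
    have : z * (D / 2) <= D ^+ 2 * x / 6 by rewrite -zrho ler_wpM2l// ltW.
    rewrite expr2 => zD; rewrite -(ler_pM2r D0); lra.
  have zD' : z <= D * (N%:R + 1) / 3 by nra.
  have zmu : z * mu <= D * (N%:R + 1) / 3 * mu by rewrite ler_wpM2r.
  (* N D^2/3 - (D (N+1) mu/3 - mu^2) equals (N-1) D (D-mu)/3 + (mu - D/3)^2 + 2 D^2/9. *)
  have : 0 <= (N%:R - 1) * (D * (D - mu)).
    by rewrite mulr_ge0 ?mulr_ge0 ?subr_ge0// ltW.
  rewrite !expr2; have := sqr_ge0 (mu - D / 3); rewrite expr2; nra.
(* For mu > D the term mu^2 >= D^2 pays for the excess D^2/3 caused by x < N + 1. *)
have zmu : z * mu <= D ^+ 2 * x / 3.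
  have : z * mu <= z * (2 * rho) by rewrite ler_wpM2l.
  lra.
have : D ^+ 2 * x <= D ^+ 2 * (N%:R + 1) by rewrite ler_wpM2l// ltW.
have : D ^+ 2 <= mu ^+ 2 by rewrite lerXn2r// ?nnegrE// ltW.
lra.
Qed.

End OneEstimate.

Lemma one_estimate_bad (R : realType) (V : finType) (c r : V -> R)
    (q p D rho x z : R) (N : nat) :
  (forall v, 0 <= c v) -> \sum_v c v = 1 ->
  (forall v, 0 <= r v) -> (forall v, r v <= z) ->
  0 <= q -> p = q + \sum_v c v * r v ->
  0 < D -> D / 2 < rho -> p <= 2 * rho -> 0 <= x -> x < N%:R + 1 ->
  z = D ^+ 2 * x / (6 * rho) ->
  \sum_(y : {ffun 'I_N -> V} | D < `|q + (\sum_j r (y j)) / N%:R - p|)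
     \prod_j c (y j) <= 3^-1.
Proof.
move=> c0 c1 r0 rz q0 pE D0 Drho p_rho x0 xN zE.
set mu := \sum_v c v * r v in pE.
have mu0 : 0 <= mu by apply: sumr_ge0 => v _; rewrite mulr_ge0.
have mu_z : mu <= z.
  rewrite -[leRHS]mul1r -c1 mulr_suml; apply: ler_sum => v _.
  by rewrite ler_wpM2l.
have rho0 : 0 < rho by lra.
(* With no walk the estimate is [q] alone, so its error is mu <= z; here x < 1 and rho > D/2 keep z
   below D. *)
case: N xN => [|N] xN.
  rewrite big_pred0 ?invr_ge0// => y; apply/negbTE; rewrite -leNgt.
  rewrite big_ord0 mul0r addr0 pE opprD addrA subrr add0r normrN ger0_norm//.
  apply: (le_trans mu_z); rewrite zE ler_pdivrMr ?mulr_gt0//.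
  rewrite add0r in xN.
  have : D ^+ 2 * x <= D ^+ 2 * 1 by rewrite ler_wpM2l ?sqr_ge0// ltW.
  have : D * (D / 2) <= D * rho by rewrite ler_wpM2l ?ltW.
  have : 0 < D * rho by rewrite mulr_gt0.
  by rewrite expr2; lra.
have N0 : 0 < N.+1%:R :> R by rewrite ltr0n.
pose g v := r v - mu.
have g0 : \sum_v c v * g v = 0.
  under eq_bigr do rewrite mulrBr.
  by rewrite sumrB -mulr_suml c1 mul1r subrr.
have gvar : \sum_v c v * g v ^+ 2 <= N.+1%:R * D ^+ 2 / 3.
  apply: le_trans (residue_variance_bound D0 Drho mu0 _ x0 xN _ zE) => //; last lra.
  have -> : \sum_v c v * g v ^+ 2 = \sum_v c v * r v ^+ 2 - mu ^+ 2.
    rewrite (eq_bigr (fun v =>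
      c v * r v ^+ 2 - 2 * mu * (c v * r v) + mu ^+ 2 * c v)); last first.
      by move=> v _; rewrite /g; ring.
    by rewrite big_split sumrB /= -!mulr_sumr c1 -/mu; ring.
  (* Residues are at most [z], so their second moment is at most [z * mu]. *)
  rewrite lerB// mulr_sumr; apply: ler_sum => v _.
  by rewrite expr2 mulrCA ler_wpM2r// mulr_ge0.
(* Summed over the walks the allowed deviation is N D, and Chebyshev gives N (N D^2/3) / (N D)^2 =
   1/3. *)
have ND0 : 0 < N.+1%:R * D by rewrite mulr_gt0.
have := product_chebyshev c0 c1 'I_N.+1 ND0 g0.
rewrite card_ord (eq_bigl (fun y : {ffun 'I_N.+1 -> V} =>
   D < `|q + (\sum_j r (y j)) / N.+1%:R - p|)).
  move=> cheb; apply: (le_trans cheb); rewrite ler_pdivrMr ?exprn_gt0//.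
  have := ler_wpM2l (ltW N0) gvar; rewrite exprMn expr2; lra.
move=> y; rewrite sumrB sumr_const card_ord -[mu *+ _]mulr_natl.
have -> : q + (\sum_j r (y j)) / N.+1%:R - p =
    (\sum_j r (y j) - N.+1%:R * mu) / N.+1%:R.
  by rewrite pE; field; rewrite addrC natr1 gt_eqF.
by rewrite normrM normfV (gtr0_norm N0) ltr_pdivlMr// mulrC.
Qed.

(** * The number of repeated estimates *)

Section NumberOfTrials.
Context (R : realType) (V : finType).
Hypothesis V0 : (0 < #|V|)%N.

Lemma n_t_ge : 18 * ln (2 * #|V|%:R ^+ 2) <= (n_t R V)%:R :> R.
Proof.
apply: (le_trans (ceil_ge _)).
by rewrite /n_t natr_absz ler_int ler_norm.
Qed.

Lemma two_sqr_card_gt1 : 1 < 2 * #|V|%:R ^+ 2 :> R.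
Proof.
have : 1 <= #|V|%:R ^+ 2 :> R by rewrite -natrX ler1n expn_gt0 V0.
by lra.
Qed.

Lemma n_t_gt0 : (0 < n_t R V)%N.
Proof.
rewrite -(ltr0n R); apply: lt_le_trans n_t_ge.
by rewrite mulr_gt0// ln_gt0// two_sqr_card_gt1.
Qed.

Lemma expR_n_t : expR (- ((n_t R V)%:R / 18)) <= (2 * #|V|%:R ^+ 2)^-1 :> R.
Proof.
rewrite expRN lef_pV2 ?posrE ?expR_gt0//; last first.
  exact: lt_trans two_sqr_card_gt1.
rewrite -ler_ln ?posrE ?expR_gt0//; last exact: lt_trans two_sqr_card_gt1.
by rewrite expRK; have := n_t_ge; lra.
Qed.

End NumberOfTrials.

(** Exchanging the sums turns the frequency-weighted residues into an average of residues at end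
    nodes, the form required by Chebyshev. *)
Lemma estimateE (R : realType) (V : finType) (e : rel V) (alpha : R) (s : V)
    (W : nat -> nat -> seq V) (nr i : nat) (t : V) (h : seq V) :
  estimate e alpha s W nr i t h =
  (bp_values e alpha t h).1 s +
  (\sum_(j < nr) (bp_values e alpha t h).2 (last s (W i j))) / nr%:R.
Proof.
rewrite /estimate; case: bp_values => q r /=; congr (_ + _).
rewrite /monte_carlo; under eq_bigr do rewrite mulrAC natr_sum mulr_suml.
rewrite -mulr_suml exchange_big /=; congr (_ / _); apply: eq_bigr => j _.
rewrite (bigD1 (last s (W i j)))//= eqxx mul1r big1 ?addr0// => v.
by rewrite eq_sym => /negbTE ->; rewrite mul0r.
Qed.

(** * Consequences of a good RBS output *)

Section RoughEstimates.
Context (R : realType) (V : finType) (e : rel V) (alpha : R) (s : V) (eps : R).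
Local Notation d v := ((deg e v)%:R : R).
Hypothesis deg_ge1 : forall v, (1 <= deg e v)%N.
Hypothesis eps_gt0 : 0 < eps.
Hypothesis ppr_sym : forall t,
  d s * ppr e alpha s t = d t * ppr e alpha t s.
Context (est : V -> R).
Local Notation delta := (4^-1 * eps * d s).
Hypothesis est_good : forall v,
  (delta <= ppr e alpha v s ->
     `|est v - ppr e alpha v s| <= 2^-1 * ppr e alpha v s) /\
  (ppr e alpha v s < delta -> est v <= ppr e alpha v s + delta).

(** Candidates have [est t > 2 * delta]. This excludes pi(t,s) < delta, so the relative error 1/2
    applies; reversibility then passes to pi(s,t). *)
Lemma ppr_le_rough t : t \in candidates e s eps est ->
  ppr e alpha s t <= 2 * ppr_rough e s est t.
Proof.
move=> /(rough_gt deg_ge1); rewrite ppr_roughE.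
have ds := deg_gt0 R deg_ge1 s; have dt := deg_gt0 R deg_ge1 t.
rewrite ltr_pdivlMr// => est_t.
have {}est_t : eps * d s / 2 < est t.
  by rewrite -(ltr_pM2r dt); lra.
have [large small] := est_good t.
have [/large|ppr_lt] := leP delta (ppr e alpha t s); last first.
  by have := small ppr_lt; lra.
rewrite ler_distl => /andP[low _].
rewrite mulrA ler_pdivlMr// mulrC ppr_sym.
have : d t * (ppr e alpha t s - 2^-1 * ppr e alpha t s) <= d t * est t.
  by rewrite ler_wpM2l// ltW.
by lra.
Qed.

(** Now [est t <= 2 * delta], so either pi(t,s) < delta or pi(t,s) <= 2 est(t) <= 4 delta = eps
    d(s), whence the factor 1/4 in delta. *)
Lemma ppr_le_noncandidate t : t \notin candidates e s eps est ->
  ppr e alpha s t <= eps * d t.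
Proof.
rewrite inE -leNgt ppr_roughE => est_t.
have ds := deg_gt0 R deg_ge1 s; have dt := deg_gt0 R deg_ge1 t.
have {}est_t : est t <= eps * d s / 2.
  move: est_t; rewrite mulrAC mulfK ?gt_eqF// ler_pdivrMr//; lra.
have ppr_t : ppr e alpha t s <= eps * d s.
  have [large _] := est_good t.
  have [/large|] := leP delta (ppr e alpha t s).
    by rewrite ler_distl => /andP[low _]; lra.
  have : 0 < eps * d s by rewrite mulr_gt0.
  by lra.
rewrite -(ler_pM2l ds) ppr_sym.
have : d t * ppr e alpha t s <= d t * (eps * d s) by rewrite ler_wpM2l// ltW.
by lra.
Qed.

End RoughEstimates.

(** * Phase III for a fixed good outcome of the first two phases *)

Section PhaseIII.
Context (R : realType) (V : finType) (e : rel V) (alpha : R) (s : V) (eps : R).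
Local Notation d v := ((deg e v)%:R : R).
Local Notation n := (#|V|%:R : R).
Hypothesis e_sym : symmetric e.
Hypothesis e_irr : irreflexive e.
Hypothesis deg_ge1 : forall v, (1 <= deg e v)%N.
Hypothesis alpha_gt0 : 0 < alpha.
Hypothesis alpha_lt1 : alpha < 1.
Hypothesis eps_gt0 : 0 < eps.
Context (est : V -> R) (pick : nat -> V -> seq V -> {set V} -> V).
Hypothesis pick_in : forall k t h A, A != finset.set0 -> pick k t h A \in A.
Context (push_cost : V -> R) (walk_cost : R).
Hypothesis push_cost_gt0 : forall v, 0 < push_cost v.
Local Notation delta := (4^-1 * eps * d s).
Hypothesis est_good : forall v,
  (delta <= ppr e alpha v s ->
     `|est v - ppr e alpha v s| <= 2^-1 * ppr e alpha v s) /\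
  (ppr e alpha v s < delta -> est v <= ppr e alpha v s + delta).

Context (d2 : measure_display) (T2 : measurableType d2) (P2 : probability T2 R).
Context (W : nat -> nat -> T2 -> seq V).
Hypothesis W_walk : forall i j, is_walk_from e alpha P2 s (W i j).
Hypothesis W_indep : mutually_independent P2 (fun ij : nat * nat => W ij.1 ij.2).

Local Notation pi := (ppr e alpha s).
Local Notation cand := (candidates e s eps est).
Local Notation N := (n_t R V).

Lemma ppr_fin_num v :
  \esum_(p in [set p : seq V | last s p = v]) (walk_prob e alpha s p)%:E
    \is a fin_num.
Proof. by rewrite -(ppr_fin v (W_walk 0 0)). Qed.

Lemma ppr_symE t : d s * pi t = d t * ppr e alpha t s.
Proof. by apply: ppr_rev => //; exact: ppr_fin_num. Qed.

Lemma ppr_source_ge0 v : 0 <= pi v.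
Proof. by rewrite -lee_fin (pprE v (W_walk 0 0)). Qed.

Definition trial_value (nr : nat) (t : V) (h : seq V) (y : {ffun 'I_nr -> V}) : R :=
  (bp_values e alpha t h).1 s +
  (\sum_j (bp_values e alpha t h).2 (y j)) / nr%:R.

Lemma trial_bad k t h : t \in cand ->
  (forall v, (bp_values e alpha t h).2 v <= ls_rmax (state_after e s eps est k) t) ->
  \sum_(y : {ffun 'I_(ls_nr (state_after e s eps est k)) -> V} |
      eps * d t < `|trial_value t h y - pi t|) \prod_j pi (y j) <= 3^-1.
Proof.
move=> tC rle.
(* The unrounded number of walks, with floor [ls_nr]; the threshold after [k] halvings is
   proportional to it. *)
pose x : R := (n_r0 V eps)%:R / 2 ^+ k.
have pow0 : 0 < 2 ^+ k :> R by exact: exprn_gt0.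
apply: (@one_estimate_bad _ _ _ _ _ _ (eps * d t) (ppr_rough e s est t) x
  (ls_rmax (state_after e s eps est k) t)) => //.
- exact: ppr_source_ge0.
- exact: ppr_sum1 (W_walk 0 0).
- by move=> v; exact: bp_residue_ge0.
- exact: bp_reserve_ge0.
- apply: bp_invariant => // v; apply: ppr_last => // w; exact: ppr_fin_num.
- by rewrite mulr_gt0// deg_gt0.
- exact: rough_gt.
- by apply: ppr_le_rough => // t'; exact: ppr_symE.
- by rewrite divr_ge0// ltW.
- rewrite /= ltr_pdivrMr// natr1 -natrX -natrM ltr_nat.
  by rewrite -ltn_divLR ?expn_gt0.
- by rewrite /= /rmax0 /x; field; rewrite !gt_eqF// (rough_gt0 deg_ge1 eps_gt0 tC).
Qed.

Lemma algD_success :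
  ((1 - (2 * n)^-1)%:E <= P2 [set w | forall t, exists2 x,
     algD e alpha s eps est pick push_cost walk_cost (fun i j => W i j w) t
       = Some x & (`|x / d t - pi t / d t| <= eps)%R])%E.
Proof.
have n0 : (0 < #|V|)%N by apply/card_gt0P; exists s.
have n0R : 0 < n by rewrite ltr0n.
have normE (x : R) t : (`|x / d t - pi t / d t| <= eps) = (`|x - pi t| <= eps * d t).
  have dt := deg_gt0 R deg_ge1 t.
  by rewrite -mulrBl normrM normfV (gtr0_norm dt) ler_pdivrMr.
have noncand t : t \notin cand -> `|0 / d t - pi t / d t| <= eps.
  move=> tC; rewrite normE sub0r normrN ger0_norm ?ppr_source_ge0//.
  by apply: (ppr_le_noncandidate deg_ge1 eps_gt0 ppr_symE est_good).
have [C0|Cn0] := eqVneq cand finset.set0.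
  rewrite [X in P2 X](_ : _ = setT).
    by rewrite probability_setT lee_fin gerBl invr_ge0 mulr_ge0// ltW.
  apply/seteqP; split => // w _ t /=; have tC : t \notin cand by rewrite C0 inE.
  by exists 0; [rewrite /algD (negbTE tC)|exact: noncand].
have [k kE] := phaseIIP e_sym e_irr deg_ge1 alpha_gt0 alpha_lt1 eps_gt0
  pick_in walk_cost push_cost_gt0 Cn0.
pose st := state_after e s eps est k.
(* The final calls do not involve the walks, so the pushed nodes are fixed before phase III; the
   default is never taken for a candidate. *)
pose hh t := odflt [::] (bp_call e alpha pick k.+1 t (ls_rmax st t)).
have hhP t : t \in cand -> bp_call e alpha pick k.+1 t (ls_rmax st t) = Some (hh t) /\
    forall v, (bp_values e alpha t (hh t)).2 v <= ls_rmax st t.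
  move=> tC; have := bp_call_state e_sym e_irr deg_ge1 alpha_gt0 alpha_lt1 eps_gt0
    pick_in k k.+1 tC ltr01.
  by rewrite mul1r /hh -/st => -[h -> hle].
pose med t (y : {ffun 'I_N -> {ffun 'I_(ls_nr st) -> V}}) :=
  kth_smallest (uphalf N) [seq trial_value t (hh t) (y i) | i <- enum 'I_N].
pose Q y := [forall t in cand, `|med t y - pi t| <= eps * d t].
have -> : [set w | forall t, exists2 x,
     algD e alpha s eps est pick push_cost walk_cost (fun i j => W i j w) t
       = Some x & `|x / d t - pi t / d t| <= eps] =
   [set w | Q [ffun i : 'I_N => [ffun j : 'I_(ls_nr st) => last s (W i j w)]]].
  have algE w t : t \in cand ->
      algD e alpha s eps est pick push_cost walk_cost (fun i j => W i j w) t =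
      Some (med t [ffun i : 'I_N => [ffun j : 'I_(ls_nr st) => last s (W i j w)]]).
    move=> tC; rewrite /algD tC kE /= -/st (hhP t tC).1; congr Some.
    rewrite /med -val_enum_ord -map_comp; congr kth_smallest.
    apply: eq_map => i; rewrite /= estimateE /trial_value; congr (_ + _ / _).
    by apply: eq_bigr => j _; rewrite !ffunE.
  apply/seteqP; split => w /= wP.
    apply/forall_inP => t tC; have [x] := wP t.
    by rewrite algE// => -[<-]; rewrite normE.
  move=> t; case: (boolP (t \in cand)) => tC.
    by rewrite algE//; eexists; first by []; rewrite normE; exact: (forall_inP wP).
  by exists 0; [rewrite /algD (negbTE tC)|exact: noncand].
rewrite (prob_endpoints W_walk W_indep) lee_fin.
pose pr (z : {ffun 'I_(ls_nr st) -> V}) := \prod_j pi (z j).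
have pr0 z : 0 <= pr z by apply: prodr_ge0 => j _; exact: ppr_source_ge0.
have pi1 := ppr_sum1 (W_walk 0 0).
have pr1 : \sum_z pr z = 1 by exact: (sum_prod_ffun1 pi1).
(* Splitting the total mass 1 along [Q] leaves an upper bound on the mass of failure to prove. *)
have := sum_prod_ffun1 pr1 'I_N; rewrite (bigID Q) /= => tot.
rewrite lerBlDr -[leLHS]tot lerD2l.
pose bad t (y : {ffun 'I_N -> {ffun 'I_(ls_nr st) -> V}}) :=
  (N <= (\sum_i (eps * d t < `|trial_value t (hh t) (y i) - pi t|)%R).*2)%N.
apply: (@le_trans _ _ (\sum_(t in cand) \sum_(y | bad t y) \prod_(i < N) pr (y i))).
  (* Union bound: if [Q] fails, [median_deviation] makes [bad] true at some candidate, so the weight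
     of [y] is counted at least once. *)
  rewrite (exchange_big_dep xpredT)//= big_mkcond /=; apply: ler_sum => y _.
  have P0 : 0 <= \prod_(i < N) pr (y i) by apply: prodr_ge0.
  case: ifPn => [|_]; last by apply: sumr_ge0.
  move=> /forall_inPn[t tC ntmed]; rewrite (bigD1 t)/=; last first.
    rewrite tC /= /bad leqNgt; apply: contra ntmed => few.
    by apply: median_deviation => //; exact: n_t_gt0.
  by rewrite lerDl sumr_ge0.
apply: (@le_trans _ _ (\sum_(t in cand) (2 * n ^+ 2)^-1)).
  apply: ler_sum => t tC.
  apply: le_trans (expR_n_t R n0).
  apply: (@product_majority _ _ pr pr0 pr1 N
    (fun z => eps * d t < `|trial_value t (hh t) z - pi t|)).
  by apply: trial_bad => //; exact: (hhP t tC).2.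
rewrite sumr_const -[leLHS]mulr_natl.
apply: (@le_trans _ _ (n * (2 * n ^+ 2)^-1)).
  rewrite ler_wpM2r ?invr_ge0 ?mulr_ge0 ?sqr_ge0// ler_nat.
  exact: max_card.
by rewrite le_eqVlt; apply/orP; left; apply/eqP; field; rewrite gt_eqF.
Qed.

End PhaseIII.

(** * Combining the phases *)

Lemma measurable_RBS_event (R : realType) (V : finType) (e : rel V) (alpha : R)
    (d : measure_display) (T : measurableType d) (P : probability T R) (t : V)
    (eps_r delta : R) (est : V -> {RV P >-> R}) :
  measurable [set w | forall v : V,
    (delta <= ppr e alpha v t ->
       `|est v w - ppr e alpha v t| <= eps_r * ppr e alpha v t) /\
    (ppr e alpha v t < delta -> est v w <= ppr e alpha v t + delta)].
Proof.
(* For each [v] exactly one clause applies, so the event is a finite intersection of preimages of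
   intervals. *)
pose B v : set R := if delta <= ppr e alpha v t
  then [set` `[ppr e alpha v t - eps_r * ppr e alpha v t,
               ppr e alpha v t + eps_r * ppr e alpha v t]]
  else [set` `]-oo, ppr e alpha v t + delta]].
rewrite (_ : [set w | _] = \bigcap_(v in [set: V]) (est v @^-1` B v)).
  apply: fin_bigcap_measurable => // v _; rewrite -[_ @^-1` _]setTI.
  by apply: measurable_funP => //; rewrite /B; case: ifP => _; exact: measurable_itv.
apply/seteqP; split => w /=.
  move=> wP v _; have [large small] := wP v; rewrite /B /=.
  case: leP => [/large|/small] /=; rewrite in_itv /= ?ler_distl//.
move=> wP v; have := wP v Logic.I; rewrite /B /=.
by case: leP => _ /=; rewrite in_itv /= ?ler_distl// => ->; split.
Qed.

Theorem theorem19 (R : realType) (V : finType) (e : rel V)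
  (e_sym : symmetric e) (e_irr : irreflexive e)
  (deg_ge1 : forall v : V, (1 <= deg e v)%N)
  (alpha : R) (alpha_gt0 : 0 < alpha) (alpha_lt1 : alpha < 1)
  (s : V) (eps_d : R) (eps_gt0 : 0 < eps_d)
  (push_cost : V -> R) (push_cost_gt0 : forall v : V, 0 < push_cost v)
  (walk_cost : R) (walk_cost_gt0 : 0 < walk_cost)
  (* randomness of phases I and II *)
  (d1 : measure_display) (T1 : measurableType d1) (P1 : probability T1 R)
  (est : V -> {RV P1 >-> R})
  (est_RBS : RBS_guarantee e alpha s 2^-1 (4^-1 * eps_d * (deg e s)%:R)
               (#|V|%:R ^+ 2)^-1 est)
  (pick : T1 -> nat -> V -> seq V -> {set V} -> V)
  (pick_in : forall (w : T1) (k : nat) (t : V) (h : seq V) (A : {set V}),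
     A != finset.set0 -> pick w k t h A \in A)
  (pick_meas : forall (k : nat) (t : V) (h : seq V) (A : {set V}) (v : V),
     measurable [set w : T1 | pick w k t h A = v])
  (* randomness of phase III *)
  (d2 : measure_display) (T2 : measurableType d2) (P2 : probability T2 R)
  (W : nat -> nat -> T2 -> seq V)
  (W_walk : forall i j : nat, is_walk_from e alpha P2 s (W i j))
  (W_indep : mutually_independent P2 (fun ij : nat * nat => W ij.1 ij.2)) :
  ((1 - (#|V|%:R)^-1)%:E <=
   (P1 \x P2) [set w : T1 * T2 | forall t : V,
      (exists2 x : R,
        algD e alpha s eps_d (est ^~ w.1) (pick w.1) push_cost walk_cost
             (fun i j => W i j w.2) t = Some x &
        `| x / (deg e t)%:R - ppr e alpha s t / (deg e t)%:R | <= eps_d)%R])%E.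
Proof.
(* [s] and one of its neighbors are two distinct nodes. *)
have n2 : 2 <= #|V|%:R :> R.
  have /card_gt0P[u] := deg_ge1 s; rewrite inE => su.
  rewrite ler_nat; apply: leq_trans (max_card [set s; u]%SET).
  by rewrite cards2; case: eqP su => [<-|//]; rewrite e_irr.
have n0 : 0 < #|V|%:R :> R by lra.
have c0 : 0 <= 1 - (2 * #|V|%:R)^-1 :> R.
  by rewrite subr_ge0 invf_le1; lra.
set A := [set w : T1 * T2 | _].
have mG := measurable_RBS_event e alpha s 2^-1 (4^-1 * eps_d * (deg e s)%:R) est.
(* The product measure is the integral of the measures of sections, each at least 1 - 1/(2n) on the
   RBS event. *)
rewrite /product_measure1.
apply: le_trans (integral_ge_on_set P1 mG c0 _ _) => //=.
  apply: le_trans (lee_wpmul2l _ est_RBS); last by rewrite lee_fin.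
  rewrite -EFinM lee_fin.
  have -> : (2 * #|V|%:R)^-1 = #|V|%:R^-1 / 2 :> R by rewrite invfM mulrC.
  (* With a = 1/n <= 1/2 one has a^2 <= a/2, hence (1 - a/2)(1 - a^2) >= 1 - a. *)
  rewrite -exprVn; set a := _^-1.
  have a0 : 0 < a by rewrite invr_gt0.
  have a2 : a <= 2^-1 by rewrite lef_pV2// posrE.
  rewrite expr2; nra.
move=> w1 good; rewrite (_ : xsection A w1 = [set w2 | A (w1, w2)]); last first.
  by apply/seteqP; split => w2; rewrite /xsection /= inE.
exact: (algD_success e_sym e_irr deg_ge1 alpha_gt0 alpha_lt1 eps_gt0
  (pick_in w1) walk_cost push_cost_gt0 good W_walk W_indep).
Qed.
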